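(* There is no family of expanders satisfying the Bakry-Émery condition $CD(0,\infty)$. That is, there do not exist constants $\Delta\ge 1$, $\rho<1$ and a sequence of finite graphs $(G_n)_{n\ge1}$, $G_n=(V_n,E_n)$, such that $|V_n|\to\infty$ as $n\to\infty$ and, for every $n\ge 1$: the maximum degree of $G_n$ is at most $\Delta$, $\lambda_2(G_n)\le\rho$, and $G_n$ satisfies $CD(0,\infty)$.
   Context: Graphs are simple and undirected. For a finite graph $G=(V_G,E_G)$, the transition matrix $P_G$ of the lazy simple random walk is $P_G(x,y)=\frac{1}{2\deg_G(x)}$ if $\{x,y\}\in E_G$, $P_G(x,x)=\frac12$, and $P_G(x,y)=0$ otherwise; if $x$ is isolated, $P_G(x,x):=1$. Its eigenvalues are ordered as $1=\lambda_1(G)\ge\lambda_2(G)\ge\dots\ge\lambda_{|V_G|}(G)\ge0$, and the spectral gap is $1-\lambda_2(G)$. A family of expanders is a sequence of finite graphs with uniformly bounded degrees, diverging sizes, and spectral gap bounded away from $0$. The condition $CD(0,\infty)$: for $f\colon V_G\to\mathbb R$ let $(Lf)(x)=\sum_{y:\{x,y\}\in E_G}(f(y)-f(x))$, let $\Gamma(f,g)=\frac12\left(L(fg)-fLg-gLf\right)$ and $\Gamma_2(f,f)=\frac12 L\Gamma(f,f)-\Gamma(f,Lf)$. The graph $G$ satisfies $CD(0,\infty)$ if $\Gamma_2(f,f)(x)\ge 0$ for every $f\colon V_G\to\mathbb R$ and every $x\in V_G$. *)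

(* Defs.v *)
From HB Require Import structures.
From mathcomp Require Import all_boot all_order all_algebra.
From mathcomp Require Import polyrcf.
From mathcomp Require Import all_classical all_reals all_analysis.

Set Implicit Arguments.
Unset Strict Implicit.
Unset Printing Implicit Defensive.

Import Order.TTheory GRing.Theory Num.Theory.

Local Open Scope ring_scope.

Record graph := Graph {
  vertex :> finType;
  edge : rel vertex;
  edge_sym : symmetric edge;
  edge_irrefl : irreflexive edge }.

Definition deg (G : graph) (x : G) : nat := #|[set y | edge x y]|.

Definition max_deg (G : graph) : nat := (\max_(x : G) deg x)%N.

Section LazyWalk.
Variables (R : realType) (G : graph).

Definition lazy_walk (x y : G) : R :=
  if y == x then (if deg x == 0%N then 1 else 2^-1)
  else if edge x y then (2 * (deg x)%:R)^-1 else 0.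

Definition transition_mx : 'M[R]_#|G| :=
  \matrix_(i, j) lazy_walk (enum_val i) (enum_val j).

(* The eigenvalues of the transition matrix, in nonincreasing order, each
   repeated according to its multiplicity. The walk is reversible, so the
   characteristic polynomial splits over R and this list has length #|G|. *)
Definition eigenvalues : seq R :=
  let p := char_poly transition_mx in
  sort >=%R (flatten [seq nseq (mup z p) z | z <- rootsR p]).

(* [lambda k] is the k-th largest eigenvalue, counting from k = 1; it takes the
   junk value 0 for k > #|G|, e.g. for [lambda 2] of a one-vertex graph. *)
Definition lambda (k : nat) : R := nth 0 eigenvalues k.-1.

End LazyWalk.

Section BakryEmery.
Variables (R : realType) (G : graph).
Implicit Types (f g : G -> R) (x : G).

Definition laplacian f x : R := \sum_(y | edge x y) (f y - f x).

Definition Gamma f g x : R :=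
  2^-1 * (laplacian (fun y => f y * g y) x
          - f x * laplacian g x - g x * laplacian f x).

Definition Gamma2 f x : R :=
  2^-1 * laplacian (Gamma f f) x - Gamma f (laplacian f) x.

Definition CD0infty : Prop := forall f x, 0 <= Gamma2 f x.

End BakryEmery.

(* Main.v *)
(** An implicit Euler step P = (1 - L)^-1 of the heat flow is a self-adjoint
    Markov operator, and CD(0,oo) gives Gamma(P f) <= P Gamma(f) for it, hence
    the reverse Poincare inequality 2 m Gamma(P^(m+1) f) <= P^m f^2 - (P^m f)^2.
    So for x ~ y the kernel K of P^(m+1) satisfies
    sum_z |K(x,z) - K(y,z)| <= m^(-1/2).  Summing over the edges and using the
    symmetry of K, some column nu = K(.,z), which is a probability vector, has
    sum_(x ~ y) |nu(x) - nu(y)| of order Delta m^(-1/2), and this bounds the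
    Dirichlet energy of sqrt(nu).  But all but 1/8 of the mass of nu lies in a
    ball whose size depends on m and Delta only, so on a large graph the
    spectral gap bounds this energy from below independently of m. *)
Require Import Defs.
From HB Require Import structures.
From mathcomp Require Import all_boot all_order all_algebra.
From mathcomp Require Import complex polyrcf ring lra.
From mathcomp Require Import all_classical all_reals all_analysis.

Set Implicit Arguments.
Unset Strict Implicit.
Unset Printing Implicit Defensive.

Import Order.TTheory GRing.Theory Num.Theory.

Local Open Scope classical_set_scope.
Local Open Scope ring_scope.

(** * Spectral theory of real symmetric matrices *)

Lemma char_poly_similar (R : comNzRingType) (n : nat) (A B M : 'M[R]_n) :
  A *m B = 1%:M -> char_poly (A *m M *m B) = char_poly M.
Proof.
move=> AB1; rewrite /char_poly /char_poly_mx.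
have AB1p : map_mx polyC A *m map_mx polyC B = 1%:M.
  by rewrite -map_mxM AB1 map_mx1.
have -> : 'X%:M - map_mx polyC (A *m M *m B) =
    map_mx polyC A *m ('X%:M - map_mx polyC M) *m map_mx polyC B.
  rewrite mulmxBr mulmxBl !map_mxM/=; congr (_ - _).
  by rewrite scalar_mxC -mulmxA AB1p mulmx1.
by rewrite !det_mulmx mulrAC -det_mulmx AB1p det1 mul1r.
Qed.

Section Spectral.
Local Open Scope sesquilinear_scope.
Local Open Scope complex_scope.

(** Over [R[i]] the matrix is Hermitian, so the spectral theorem for normal matrices applies and the
    diagonal is real. The factorization of [char_poly S] is checked in [R[i]] and pulled back along
    the injective embedding; the eigenbasis [U] stays complex. *)
Lemma symmetric_spectral (R : rcfType) (n : nat) (S : 'M[R]_n) : S^T = S ->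
  exists (d : 'rV[R]_n) (U : 'M[R[i]]_n),
    [/\ U \is unitarymx,
        map_mx (real_complex R) S =
          U^t* *m diag_mx (map_mx (real_complex R) d) *m U
      & char_poly S = \prod_(i < n) ('X - (d 0 i)%:P)].
Proof.
move=> Ssym; set A := map_mx (real_complex R) S.
have Aherm : A \is hermsymmx.
  apply: realsym_hermsym.
    apply/is_hermitianmxP; rewrite expr0 scale1r.
    by apply/matrixP => i j; rewrite !mxE -{1}Ssym mxE.
  by apply/mxOverP => i j; rewrite mxE complex_real.
have /orthomx_spectralP Adec := hermitian_normalmx Aherm.
have dreal := hermitian_spectral_diag_real Aherm.
set U := spectralmx A in Adec; set D := spectral_diag A in Adec dreal.
have Uu : U \is unitarymx by exact: spectral_unitarymx.
exists (map_mx (@complex.Re R) D), U.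
have DE : map_mx (real_complex R) (map_mx (@complex.Re R) D) = D.
  by apply/matrixP => i j; rewrite !mxE RRe_real// (mxOverP dreal).
rewrite DE -invmx_unitary//; split => //.
apply: (map_poly_inj (real_complex R)).
rewrite map_char_poly -/A Adec char_poly_similar; last first.
  by rewrite mulVmx// unitarymx_unit.
rewrite char_poly_trig ?diag_mx_is_trig// rmorph_prod/=.
by apply: eq_bigr => i _; rewrite map_polyXsubC -[in LHS]DE !mxE eqxx.
Qed.

(** The eigenvector [e], of eigenvalue 1 > [rho], occupies the single index allowed above [rho]. A
    vector orthogonal to [e] has no coordinate there, so only eigenvalues at most [rho] contribute
    to its quadratic form. *)
Lemma symmetric_rayleigh (R : rcfType) (n : nat) (S : 'M[R]_n) (rho : R)
    (e : 'rV[R]_n) : S^T = S -> e *m S = e -> e != 0 -> rho < 1 ->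
  (forall d : 'rV[R]_n, char_poly S = \prod_(i < n) ('X - (d 0 i)%:P) ->
     forall i j, rho < d 0 i -> rho < d 0 j -> i = j) ->
  forall v : 'rV[R]_n, (v *m e^T) 0 0 = 0 ->
    (v *m S *m v^T) 0 0 <= rho * (v *m v^T) 0 0.
Proof.
move=> Ssym eS e0 rho1 + v ve.
have [d [U [Uu SE cpS]]] := symmetric_spectral Ssym => /(_ d cpS) d_uniq.
have UK : U^t* *m U = 1%:M.
  by rewrite -invmx_unitary// mulVmx// unitarymx_unit.
(* Coordinates in the complex eigenbasis: [dotE] is Parseval's identity, and [quadE] diagonalizes
   the quadratic form. *)
pose c (x : 'rV[R]_n) := map_mx (real_complex R) x *m U^t*.
have tC (x : 'rV[R]_n) :
    (map_mx (real_complex R) x)^t* = map_mx (real_complex R) x^T.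
  by apply/matrixP => i j; rewrite !mxE conj_Creal ?complex_real.
have cT x : (c x)^t* = U *m map_mx (real_complex R) x^T.
  by rewrite /c trmx_mul map_mxM/= trmxCK tC.
have dotE x y : ((x *m y^T) 0 0)%:C = \sum_i c x 0 i * (c y 0 i)^*%R.
  transitivity ((map_mx (real_complex R) (x *m y^T)) 0 0).
    by rewrite [RHS]mxE.
  rewrite map_mxM -[map_mx _ x]mulmx1 -UK !mulmxA -mulmxA -cT -/(c x) mxE.
  by apply: eq_bigr => i _; rewrite !mxE.
have quadE x : ((x *m S *m x^T) 0 0)%:C =
    \sum_i (d 0 i)%:C * (c x 0 i * (c x 0 i)^*%R).
  transitivity ((map_mx (real_complex R) (x *m S *m x^T)) 0 0).
    by rewrite [RHS]mxE.
  rewrite !map_mxM SE !mulmxA -mulmxA -cT -/(c x) mxE.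
  apply: eq_bigr => i _; rewrite mul_mx_diag !mxE.
  by rewrite mulrCA mulrA.
have ce i : c e 0 i * (d 0 i)%:C = c e 0 i.
  have /matrixP /(_ 0 i) : c e *m diag_mx (map_mx (real_complex R) d) = c e.
    rewrite -[LHS]mulmx1 -(unitarymxP Uu) /c -[in RHS]eS map_mxM SE.
    by rewrite !mulmxA.
  by rewrite mul_mx_diag !mxE.
have [i0 ci0] : exists i, c e 0 i != 0.
  apply/existsP; apply: contraR e0; rewrite negb_exists => /forallP c0.
  have cE0 : c e = 0.
    apply/matrixP => i j; rewrite (ord1 i) [RHS]mxE.
    by have := c0 j; rewrite negbK => /eqP.
  rewrite -(map_mx_eq0 (real_complex R)) -[map_mx _ e]mulmx1 -UK mulmxA.
  by rewrite -/(c e) cE0 mul0mx.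
have di0 : d 0 i0 = 1.
  apply: (@complexI R); apply: (mulfI ci0); by rewrite ce mulr1.
have d_le i : i != i0 -> d 0 i <= rho.
  move=> ii0; rewrite leNgt; apply: contra ii0 => rhod; apply/eqP.
  by apply: d_uniq => //; rewrite di0.
have ce0 i : i != i0 -> c e 0 i = 0.
  move=> ii0; apply/eqP; apply/negPn/negP => cei.
  suff : d 0 i = 1 by have := d_le _ ii0 => /[swap] ->; rewrite leNgt rho1.
  by apply: (@complexI R); apply: (mulfI cei); rewrite ce mulr1.
(* Only the coordinate [i0] of [e] is nonzero, so orthogonality reduces to a single product. *)
have cv0 : c v 0 i0 = 0.
  have := dotE v e; rewrite ve (bigD1 i0)//= big1 ?addr0; last first.
    by move=> i ii0; rewrite ce0// rmorph0 mulr0.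
  move=> /esym/eqP; rewrite mulf_eq0 conjC_eq0 (negbTE ci0) orbF.
  by move/eqP.
rewrite -lecR rmorphM/= quadE dotE mulr_sumr; apply: ler_sum => i _.
have [->|ii0] := eqVneq i i0; first by rewrite cv0 !(mul0r, mulr0).
apply: ler_wpM2r; last by rewrite lecR d_le.
exact: mul_conjC_ge0.
Qed.

End Spectral.

(** * The sorted eigenvalue list and its second entry *)

Lemma uniq_rootsR (R : rcfType) (p : {poly R}) : uniq (rootsR p).
Proof. exact: lt_sorted_uniq (sorted_roots _ _ _). Qed.

Lemma mem_rootsR (R : rcfType) (p : {poly R}) (x : R) :
  p != 0 -> (x \in rootsR p) = root p x.
Proof. by move=> p0; rewrite -(roots_on_rootsR p0). Qed.

(** In both lists the number of occurrences of [z] is the multiplicity of [z] as a root of the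
    characteristic polynomial. *)
Lemma perm_eigenvalues (R : realType) (G : graph) (s : seq R) :
  char_poly (transition_mx R G) = \prod_(x <- s) ('X - x%:P) ->
  perm_eq (eigenvalues R G) s.
Proof.
move=> pE; rewrite /eigenvalues perm_sort; apply/allP => z _ /=; apply/eqP.
rewrite count_flatten -map_comp sumnE big_map -(mu_prod_XsubC z) -pE.
set p := char_poly _.
have p0 : p != 0 by rewrite monic_neq0// char_poly_monic.
have countE x : (count_mem z \o (fun x => nseq (mup x p) x)) x =
    if x == z then mup z p else 0%N.
  by rewrite /= count_nseq /=; case: eqP => [->|_]; rewrite ?mul1n ?mul0n.
rewrite (eq_bigr _ (fun x _ => countE x)) -big_mkcond/=.
have [zr|zr] := boolP (z \in rootsR p).
  rewrite big_const_seq -/(count_mem z _) count_uniq_mem ?uniq_rootsR//.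
  by rewrite zr iter_addn_0 muln1.
rewrite big_const_seq -/(count_mem z _) (count_memPn zr).
by rewrite mupNroot -?mem_rootsR.
Qed.

(** Two such indices would give two entries above [rho] in the sorted list, yet all entries from the
    second on are at most [lambda 2]. *)
Lemma eigenvalue_gt_lambda2 (R : realType) (G : graph) (rho : R)
    (d : 'rV[R]_#|G|) : lambda R G 2 <= rho ->
  char_poly (transition_mx R G) = \prod_(i < #|G|) ('X - (d 0 i)%:P) ->
  forall i j, rho < d 0 i -> rho < d 0 j -> i = j.
Proof.
move=> l2 pE i j di dj; apply/eqP/negPn/negP => ij.
have : perm_eq (eigenvalues R G) [seq d 0 k | k <- enum 'I_#|G|].
  by apply: perm_eigenvalues; rewrite big_map big_enum.
move=> /permP /(_ (> rho)); rewrite count_map.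
have : (2 <= count (preim (d 0%R) (> rho)) (enum 'I_#|G|))%N.
  rewrite -size_filter.
  have /uniq_leq_size /= : uniq [:: i; j] by rewrite /= inE ij.
  apply=> k; rewrite !inE mem_filter mem_enum andbT /=.
  by case/orP => /eqP ->.
move=> /[swap] <-; apply/negP; rewrite -leqNgt.
move: l2; rewrite /lambda/=.
have : sorted >=%R (eigenvalues R G).
  by apply: sort_sorted => x y; exact: ge_total.
(* A list of length at most one has at most one entry above [rho]; this covers the graphs where
   [lambda 2] takes its default value 0. *)
case: (eigenvalues R G) => [//|x [|y s]] /=; first by rewrite addn0 leq_b1.
move=> /andP[_]; rewrite (path_sortedE ge_trans) => /andP[/allP ys _] yr.
suff -> : count (> rho) s = 0%N by rewrite (ltNge rho y) yr /= !addn0 leq_b1.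
apply/eqP; rewrite -leqn0 leqNgt -has_count; apply/negP => /hasP[t ts].
by apply/negP; rewrite -leNgt (le_trans _ yr)//; exact: ys.
Qed.

(** * Reversibility of the lazy walk and the Poincaré inequality *)

Definition dirichlet (R : realType) (G : graph) (f : G -> R) : R :=
  \sum_x \sum_(y | edge x y) (f y - f x) ^+ 2.

Lemma sum_deg (R : realType) (G : graph) (x : G) (c : R) :
  \sum_(y | edge x y) c = (deg x)%:R * c.
Proof.
rewrite sumr_const mulr_natl; congr (_ *+ _).
by apply: eq_card => y; rewrite inE.
Qed.

Section WeightedWalk.
Variables (R : realType) (G : graph).

(* An isolated vertex gets weight 1, so that the walk is reversible with
   positive weights on every graph. *)
Definition walk_weight (x : G) : R := (maxn (deg x) 1)%:R.

Lemma walk_weight_ge1 x : 1 <= walk_weight x.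
Proof. by rewrite (ler_nat _ 1) leq_maxr. Qed.

Lemma walk_weight_gt0 x : 0 < walk_weight x.
Proof. exact: lt_le_trans ltr01 (walk_weight_ge1 x). Qed.

(** The symmetric edge weights of the reversible walk: 1/2 on every edge, with the remaining weight
    of a vertex on its loop. *)
Definition conductance (x y : G) : R := walk_weight x * lazy_walk R x y.

Lemma edge_deg_neq0 (x y : G) : edge x y -> (deg x == 0)%N = false.
Proof.
move=> xy; apply/negbTE; rewrite -lt0n; apply/card_gt0P.
by exists y; rewrite inE.
Qed.

Lemma conductance_edge x y : edge x y -> conductance x y = 2^-1.
Proof.
move=> xy; have d0 := edge_deg_neq0 xy.
rewrite /conductance /lazy_walk xy; case: eqP => [yx|_].
  by move: xy; rewrite yx edge_irrefl.
rewrite /walk_weight (maxn_idPl _) ?lt0n ?d0// invfM mulrCA divff ?mulr1//.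
by rewrite pnatr_eq0 d0.
Qed.

Lemma conductance_nonedge x y : y != x -> ~~ edge x y -> conductance x y = 0.
Proof.
by rewrite /conductance /lazy_walk => /negbTE -> /negbTE ->; rewrite mulr0.
Qed.

Lemma conductance_sym x y : conductance x y = conductance y x.
Proof.
have [->//|yx] := eqVneq y x.
have [xy|xy] := boolP (edge x y).
  by rewrite !conductance_edge// edge_sym.
by rewrite !conductance_nonedge// 1?eq_sym// edge_sym.
Qed.

Lemma sum_conductance x : \sum_y conductance x y = walk_weight x.
Proof.
rewrite (bigD1 x)//= (bigID (edge x))/=.
rewrite [X in _ + (_ + X)]big1 ?addr0; last first.
  by move=> y /andP[]; exact: conductance_nonedge.
rewrite (eq_bigl (edge x)); last first.
  by move=> y; case: eqP => [->|//]; rewrite edge_irrefl.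
rewrite (eq_bigr (fun=> 2^-1)); last by move=> y; exact: conductance_edge.
rewrite sum_deg /conductance /lazy_walk eqxx /walk_weight.
have [->|d0] := eqVneq (deg x) 0%N; first by rewrite mul0r addr0 mulr1.
by rewrite (maxn_idPl _) ?lt0n// -splitr.
Qed.

Lemma sum_conductance_sqr (f : G -> R) :
  \sum_x \sum_y conductance x y * (f y - f x) ^+ 2 = 2^-1 * dirichlet f.
Proof.
rewrite mulr_sumr; apply: eq_bigr => x _; rewrite mulr_sumr.
rewrite [RHS]big_mkcond; apply: eq_bigr => y _.
have [xy|xy] := boolP (edge x y); first by rewrite conductance_edge.
have [->|yx] := eqVneq y x; first by rewrite subrr expr0n/= mulr0.
by rewrite conductance_nonedge// mul0r.
Qed.

(** Expand the square [(f y - f x) ^+ 2]: by symmetry of the conductances both pure squares give the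
    same weighted sum ([E1] and [E2]). *)
Lemma conductance_polarization (f : G -> R) :
  2^-1 * dirichlet f = 2 * (\sum_x walk_weight x * f x ^+ 2
    - \sum_x \sum_y conductance x y * (f x * f y)).
Proof.
rewrite -sum_conductance_sqr.
have E1 : \sum_x \sum_y conductance x y * f x ^+ 2 =
    \sum_x walk_weight x * f x ^+ 2.
  by apply: eq_bigr => x _; rewrite -sum_conductance mulr_suml.
have E2 : \sum_x \sum_y conductance x y * f y ^+ 2 =
    \sum_x walk_weight x * f x ^+ 2.
  rewrite exchange_big/= -E1; apply: eq_bigr => x _; apply: eq_bigr => y _.
  by rewrite conductance_sym.
rewrite mulrBr -[2 * _]/((1 + 1) * _) mulrDl mul1r -{1}E2 -E1 mulr_sumr.
rewrite -big_split/= -sumrB; apply: eq_bigr => x _.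
rewrite mulr_sumr -big_split/= -sumrB; apply: eq_bigr => y _.
ring.
Qed.

Lemma sum_enum_val (F : G -> R) : \sum_x F x = \sum_(i < #|G|) F (enum_val i).
Proof. by rewrite (reindex _ (onW_bij _ (@enum_val_bij G))). Qed.

(** Conjugating the transition matrix by the square roots of the weights makes it symmetric without
    changing its characteristic polynomial. Constants become the fixed vector [e], and the weighted
    mean of [f] becomes the inner product of [v] with [e]. *)
Lemma rayleigh_le_lambda2 (rho : R) (f : G -> R) : lambda R G 2 <= rho ->
  rho < 1 -> \sum_x walk_weight x * f x = 0 ->
  \sum_x \sum_y conductance x y * (f x * f y) <=
    rho * \sum_x walk_weight x * f x ^+ 2.
Proof.
move=> l2 rho1 f0.
have [/eqP G0|G0] := posnP #|G|.
  have noG (x : G) : False by move/card0_eq: (eqP G0) => /(_ x).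
  by rewrite !big1 ?mulr0// => x; case: (noG x).
pose s (i : 'I_#|G|) : R := Num.sqrt (walk_weight (enum_val i : G)).
have s0 i : s i != 0 by rewrite gt_eqF// sqrtr_gt0 walk_weight_gt0.
have ss i : s i * s i = walk_weight (enum_val i).
  by rewrite -expr2 /s sqr_sqrtr// ltW// walk_weight_gt0.
pose A : 'M[R]_#|G| := diag_mx (\row_i s i).
pose B : 'M[R]_#|G| := diag_mx (\row_i (s i)^-1).
pose S := A *m transition_mx R G *m B.
have SE i j : S i j = conductance (enum_val i) (enum_val j) / (s i * s j).
  rewrite /S mul_mx_diag mul_diag_mx !mxE /conductance -ss.
  by field; rewrite s0 s0.
have AB : A *m B = 1%:M.
  apply/matrixP => i j; rewrite mul_diag_mx !mxE.
  by have [->|] := eqVneq i j; rewrite ?mulr1n ?mulr0n ?mulr0// divff.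
have Ssym : S^T = S.
  by apply/matrixP => i j; rewrite [LHS]mxE !SE conductance_sym [s j * _]mulrC.
pose e : 'rV[R]_#|G| := \row_i s i.
have eS : e *m S = e.
  apply/rowP => j; rewrite [LHS]mxE [RHS]mxE.
  transitivity
    (\sum_(i < #|G|) conductance (enum_val j) (enum_val i : G) / s j).
    apply: eq_bigr => i _; rewrite [e 0 i]mxE SE conductance_sym.
    by field; rewrite s0 s0.
  rewrite -mulr_suml -(sum_enum_val (conductance (enum_val j))).
  by rewrite sum_conductance -ss mulfK.
have e0 : e != 0.
  apply/eqP => /rowP /(_ (Ordinal G0)); rewrite !mxE => /eqP.
  by rewrite (negbTE (s0 _)).
pose v : 'rV[R]_#|G| := \row_i (s i * f (enum_val i)).
have ve : (v *m e^T) 0 0 = 0.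
  rewrite mxE -[RHS]f0 sum_enum_val; apply: eq_bigr => i _.
  by rewrite !mxE -ss; ring.
have := symmetric_rayleigh Ssym eS e0 rho1 _ ve.
have -> : (v *m S *m v^T) 0 0 = \sum_x \sum_y conductance x y * (f x * f y).
  rewrite mxE exchange_big/= sum_enum_val; apply: eq_bigr => j _.
  rewrite [v^T _ _]mxE [v 0 j]mxE [(v *m S) _ _]mxE mulr_suml sum_enum_val.
  apply: eq_bigr => i _; rewrite [v 0 i]mxE SE.
  by field; rewrite s0 s0.
have -> : (v *m v^T) 0 0 = \sum_x walk_weight x * f x ^+ 2.
  rewrite mxE sum_enum_val; apply: eq_bigr => i _.
  by rewrite !mxE -ss; ring.
apply => d dE; apply: (eigenvalue_gt_lambda2 l2).
by rewrite -dE /S char_poly_similar.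
Qed.

(** Both sides are invariant under adding a constant, so [f] may be centred at its weighted mean.
    Since the weights are at least 1, the weighted sum of squares dominates the plain one. *)
Lemma poincare (rho : R) (f : G -> R) : lambda R G 2 <= rho -> rho < 1 ->
  4 * (1 - rho) * (#|G|%:R * (\sum_x f x ^+ 2) - (\sum_x f x) ^+ 2) <=
    #|G|%:R * dirichlet f.
Proof.
move=> l2 rho1.
have [/eqP G0|G0] := posnP #|G|.
  have noG (x : G) : False by move/card0_eq: (eqP G0) => /(_ x).
  by rewrite (eqP G0) !mul0r big1 ?expr0n/= ?subrr ?mulr0// => x; case: (noG x).
pose W : R := \sum_(x : G) walk_weight x.
have W0 : 0 < W.
  move/card_gt0P : G0 => [x0 _]; rewrite /W (bigD1 x0)//= ltr_pwDl//.
    exact: walk_weight_gt0.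
  by apply: sumr_ge0 => x _; exact/ltW/walk_weight_gt0.
pose c := (\sum_x walk_weight x * f x) / W.
pose g x := f x - c.
have g0 : \sum_x walk_weight x * g x = 0.
  under eq_bigr do rewrite mulrBr; rewrite sumrB -mulr_suml -/W /c.
  by field; rewrite gt_eqF.
have dirg : dirichlet g = dirichlet f.
  apply: eq_bigr => x _; apply: eq_bigr => y _; rewrite /g; congr (_ ^+ _).
  ring.
have ray := rayleigh_le_lambda2 l2 rho1 g0.
have pol := conductance_polarization g.
have wg : \sum_x g x ^+ 2 <= \sum_x walk_weight x * g x ^+ 2.
  apply: ler_sum => x _; rewrite ler_peMl ?sqr_ge0//; exact: walk_weight_ge1.
have varE : #|G|%:R * (\sum_x f x ^+ 2) - (\sum_x f x) ^+ 2 =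
    #|G|%:R * (\sum_x g x ^+ 2) - (\sum_x g x) ^+ 2.
  have -> : \sum_x g x = \sum_x f x - #|G|%:R * c.
    by rewrite sumrB sumr_const mulr_natl.
  have -> : \sum_x g x ^+ 2 =
      \sum_x f x ^+ 2 - 2 * c * \sum_x f x + #|G|%:R * c ^+ 2.
    rewrite mulr_sumr -sumrB [#|G|%:R * _]mulr_natl -sumr_const -big_split/=.
    by apply: eq_bigr => x _; rewrite /g; ring.
  ring.
have n0 : 0 <= #|G|%:R :> R by [].
rewrite -dirg varE.
(* The 4 combines the conductance 1/2 of an edge with the factor 2 of the polarization; [dirichlet]
   counts each edge in both directions. *)
have h : 4 * (1 - rho) * (\sum_x g x ^+ 2) <= dirichlet g by nra.
have := sqr_ge0 (\sum_x g x); nra.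
Qed.

End WeightedWalk.

(** * The resolvent of the Laplacian as a self-adjoint Markov operator *)

Section Resolvent.
Variables (R : realType) (G : graph).
Implicit Types (f g h : G -> R) (x y : G).

Local Notation L := (@laplacian R G).

Lemma laplacianD f g x : L (fun y => f y + g y) x = L f x + L g x.
Proof. by rewrite -big_split; apply: eq_bigr => y _ /=; ring. Qed.

Lemma laplacianZ c f x : L (fun y => c * f y) x = c * L f x.
Proof. by rewrite mulr_sumr; apply: eq_bigr => y _ /=; ring. Qed.

Lemma laplacian_cst c x : L (fun=> c) x = 0.
Proof. by rewrite /laplacian big1// => y _; rewrite subrr. Qed.

Lemma laplacianB f g x : L (fun y => f y - g y) x = L f x - L g x.
Proof. by rewrite -sumrB; apply: eq_bigr => y _ /=; ring. Qed.

Lemma laplacian_sym f g : \sum_x f x * L g x = \sum_x L f x * g x.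
Proof.
have E a b : \sum_x a x * L b x =
    \sum_x \sum_(y | edge x y) a x * b y - \sum_x (deg x)%:R * (a x * b x).
  rewrite -sumrB; apply: eq_bigr => x _.
  by rewrite mulr_sumr -sum_deg -sumrB; apply: eq_bigr => y _; ring.
rewrite E [RHS](eq_bigr (fun x => g x * L f x)); last first.
  by move=> x _; exact: mulrC.
rewrite E; congr (_ - _).
  rewrite (exchange_big_dep predT)//=; apply: eq_bigr => x _.
  by apply: eq_big => y; [rewrite edge_sym|rewrite mulrC].
by apply: eq_bigr => x _; rewrite [f x * _]mulrC.
Qed.

(** At a minimum point of [h] the Laplacian is nonnegative, so the minimum value itself is
    nonnegative. *)
Lemma min_principle h : (forall x, 0 <= h x - L h x) -> forall x, 0 <= h x.
Proof.
move=> hL x.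
have [x0 _ x0min] := @arg_minP _ R G x xpredT h isT.
have L0 : 0 <= L h x0.
  by apply: sumr_ge0 => y _; rewrite subr_ge0 x0min.
have := hL x0; have := x0min x isT; lra.
Qed.

Lemma resolvent_unique f g : (forall x, f x - L f x = g x - L g x) -> f = g.
Proof.
move=> fg; apply/funext => x; apply/eqP; rewrite -subr_eq0 eq_le.
apply/andP; split.
  rewrite -oppr_ge0 opprB; apply: (@min_principle (fun x => g x - f x)) => y.
  by rewrite laplacianB; have := fg y; lra.
apply: (@min_principle (fun x => f x - g x)) => y.
by rewrite laplacianB; have := fg y; lra.
Qed.

(** In finite dimension the injectivity of 1 - L, given by [resolvent_unique], makes it surjective;
    [A] is its matrix acting on row vectors. *)
Lemma resolvent_exists f : exists g, forall x, g x - L g x = f x.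
Proof.
pose F (v : 'rV[R]_#|G|) x := v 0 (enum_rank x).
pose A : 'M[R]_#|G| := \matrix_(i, j)
  (F (delta_mx 0 i) (enum_val j) - L (F (delta_mx 0 i)) (enum_val j)).
have vA v j : (v *m A) 0 j = F v (enum_val j) - L (F v) (enum_val j).
  have FE x : F v x = \sum_i v 0 i * F (delta_mx 0 i) x.
    rewrite (bigD1 (enum_rank x))//= big1 ?addr0 /F ?mxE ?eqxx ?mulr1//.
    by move=> i ix; rewrite mxE [_ == i]eq_sym (negbTE ix) mulr0.
  have -> : L (F v) (enum_val j) =
      \sum_i v 0 i * L (F (delta_mx 0 i)) (enum_val j).
    under [RHS]eq_bigr do rewrite mulr_sumr.
    rewrite exchange_big/=; apply: eq_bigr => y _.
    by rewrite !FE -sumrB; apply: eq_bigr => i _; rewrite mulrBr.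
  rewrite FE -sumrB mxE; apply: eq_bigr => i _.
  by rewrite [A i j]mxE mulrBr.
have Aunit : A \in unitmx.
  rewrite -row_free_unit; apply: inj_row_free => v vA0.
  have F0 : F v = F 0.
    apply: resolvent_unique => x.
    by rewrite -[x]enum_rankK -vA -vA vA0 mul0mx.
  apply/rowP => k; rewrite -[k]enum_valK.
  exact: (congr1 (@^~ (enum_val k)) F0).
exists (F ((\row_i f (enum_val i)) *m invmx A)) => x.
by rewrite -[x]enum_rankK -vA mulmxKV// mxE.
Qed.

Definition resolvent f : G -> R := projT1 (cid (resolvent_exists f)).

Local Notation P := resolvent.

Lemma resolventP f x : P f x - L (P f) x = f x.
Proof. by rewrite /resolvent; case: cid. Qed.

Lemma resolventK g : P (fun x => g x - L g x) = g.
Proof. by apply: resolvent_unique => x; rewrite resolventP. Qed.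

Lemma resolvent_ge0 f : (forall x, 0 <= f x) -> forall x, 0 <= P f x.
Proof. by move=> f0; apply: min_principle => x; rewrite resolventP. Qed.

Lemma resolventB f g : P (fun x => f x - g x) = fun x => P f x - P g x.
Proof.
apply: resolvent_unique => x; rewrite laplacianB resolventP -(resolventP f).
by rewrite -(resolventP g); ring.
Qed.

Lemma resolventD f g : P (fun x => f x + g x) = fun x => P f x + P g x.
Proof.
apply: resolvent_unique => x; rewrite laplacianD resolventP -(resolventP f).
by rewrite -(resolventP g); ring.
Qed.

Lemma resolventZ c f : P (fun x => c * f x) = fun x => c * P f x.
Proof.
apply: resolvent_unique => x; rewrite laplacianZ resolventP -(resolventP f).
by ring.
Qed.

Lemma resolvent_cst c : P (fun=> c) = fun=> c.
Proof.
by apply: resolvent_unique => x; rewrite resolventP laplacian_cst subr0.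
Qed.

Lemma resolvent_le f g : (forall x, f x <= g x) -> forall x, P f x <= P g x.
Proof.
move=> fg x; rewrite -subr_ge0; have := @resolvent_ge0 (fun x => g x - f x).
by rewrite resolventB; apply => y; rewrite subr_ge0.
Qed.

Lemma resolvent_sym f g : \sum_x f x * P g x = \sum_x P f x * g x.
Proof.
transitivity (\sum_x (P f x - L (P f) x) * P g x).
  by apply: eq_bigr => x _; rewrite resolventP.
transitivity (\sum_x P f x * (P g x - L (P g) x)); last first.
  by apply: eq_bigr => x _; rewrite resolventP.
under eq_bigr do rewrite mulrBl; rewrite sumrB -laplacian_sym -sumrB.
by apply: eq_bigr => x _; rewrite mulrBr.
Qed.

Lemma laplacian_resolvent f x : L (P f) x = P (L f) x.
Proof.
have : P (fun x => f x - L f x) = f by exact: resolventK.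
rewrite resolventB => /(congr1 (@^~ x)) /=; have := resolventP f x; lra.
Qed.

Definition resolvent_iter m f : G -> R := iter m P f.

Lemma resolvent_iterSr m f : resolvent_iter m.+1 f = resolvent_iter m (P f).
Proof. exact: iterSr. Qed.

Lemma resolvent_iter_le m f g :
  (forall x, f x <= g x) ->
  forall x, resolvent_iter m f x <= resolvent_iter m g x.
Proof. by move=> fg; elim: m => [|m IH] //=; exact: resolvent_le. Qed.

Lemma resolvent_iter_cst m c : resolvent_iter m (fun=> c) = fun=> c.
Proof. by elim: m => [|m /= ->] //; exact: resolvent_cst. Qed.

Lemma resolvent_iter_ge0 m f :
  (forall x, 0 <= f x) -> forall x, 0 <= resolvent_iter m f x.
Proof.
move=> f0 x; have := @resolvent_iter_le m (fun=> 0) f f0 x.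
by rewrite resolvent_iter_cst.
Qed.

Lemma resolvent_iter_sym m f g :
  \sum_x f x * resolvent_iter m g x = \sum_x resolvent_iter m f x * g x.
Proof.
elim: m f => [//|m IH] f.
under [RHS]eq_bigr do rewrite resolvent_iterSr.
by rewrite -IH resolvent_sym.
Qed.

End Resolvent.

(** * Gradient estimates under the curvature condition *)

Section Gradient.
Variables (R : realType) (G : graph).
Implicit Types (f g h : G -> R) (x y z : G).

Local Notation L := (@laplacian R G).
Local Notation P := (@resolvent R G).

Lemma GammaE f g x :
  Gamma f g x = 2^-1 * \sum_(y | edge x y) (f y - f x) * (g y - g x).
Proof.
rewrite /Gamma; congr (_ * _); rewrite /laplacian !mulr_sumr -!sumrB.
by apply: eq_bigr => y _; ring.
Qed.

Lemma Gamma_ge0 f x : 0 <= Gamma f f x.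
Proof.
by rewrite GammaE mulr_ge0// sumr_ge0// => y _; rewrite -expr2 sqr_ge0.
Qed.

Lemma GammaB f g x : Gamma (fun y => f y - g y) (fun y => f y - g y) x =
  Gamma f f x - 2 * Gamma f g x + Gamma g g x.
Proof.
rewrite !GammaE [2 * _]mulrCA -mulrBr -mulrDr; congr (_ * _).
by rewrite mulr_sumr -sumrB -big_split; apply: eq_bigr => y _ /=; ring.
Qed.

Lemma laplacian_sqr f x :
  L (fun y => f y ^+ 2) x = 2 * (f x * L f x) + 2 * Gamma f f x.
Proof.
rewrite /Gamma -[L (fun y => f y * f y) x]/(L (fun y => f y ^+ 2) x).
by field.
Qed.

Lemma sqr_edge_le_Gamma f x y : edge x y -> (f y - f x) ^+ 2 <= 2 * Gamma f f x.
Proof.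
move=> xy; rewrite GammaE mulrA divff// mul1r (bigD1 y)//= -expr2 lerDl.
by apply: sumr_ge0 => w _; rewrite -expr2 sqr_ge0.
Qed.

(** With g = P f one has f = g - L g. Expanding Gamma(f) and using Gamma2(g) >= 0 gives Gamma(f) >=
    Gamma(g) - L Gamma(g), to which the positive operator P is applied. *)
Lemma Gamma_resolvent_le f x : CD0infty R G ->
  Gamma (P f) (P f) x <= P (Gamma f f) x.
Proof.
move=> CD; set g := P f.
rewrite -[Gamma g g]resolventK; apply: resolvent_le => y.
have -> : f = fun w => g w - L g w.
  by apply/funext => w; rewrite resolventP.
rewrite GammaB; have := CD g y; rewrite /Gamma2.
have := Gamma_ge0 (L g) y; lra.
Qed.

(** With g = P f, the square of f = g - L g equals (g^2 - L g^2) + 2 Gamma(g) + (L g)^2. Drop the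
    last term and apply P, which sends the bracket to g^2. *)
Lemma Gamma_resolvent_le_variance f x :
  2 * P (Gamma (P f) (P f)) x <= P (fun y => f y ^+ 2) x - P f x ^+ 2.
Proof.
set g := P f.
have -> : g x ^+ 2 = P (fun y => g y ^+ 2 - L (fun w => g w ^+ 2) y) x.
  by rewrite (resolventK (fun y => g y ^+ 2)).
rewrite -[2 * _]/((fun y => 2 * P (Gamma g g) y) x) -resolventZ.
rewrite -[X in _ <= X]/((fun y => P _ y - P _ y) x) -resolventB.
apply: resolvent_le => y; rewrite laplacian_sqr -(resolventP f y) -/g.
by have := sqr_ge0 (L g y); lra.
Qed.

(** Induction on [m]: apply P to the inequality for h = P^m f, then add the variance bound for h,
    which supplies one more 2 P Gamma(P h). The commutation Gamma(P P h) <= P Gamma(P h) accounts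
    for the extra iterate on the left. *)
Lemma reverse_poincare m f x : CD0infty R G ->
  2 * m%:R * Gamma (resolvent_iter m.+1 f) (resolvent_iter m.+1 f) x <=
  resolvent_iter m (fun y => f y ^+ 2) x - resolvent_iter m f x ^+ 2.
Proof.
move=> CD; elim: m x => [|m IH] x; first by rewrite mulr0 mul0r subrr.
rewrite /=; set h := resolvent_iter m f in IH *.
have step : P (fun y => h y ^+ 2 + 2 * m%:R * Gamma (P h) (P h) y) x <=
    P (resolvent_iter m (fun y => f y ^+ 2)) x.
  by apply: resolvent_le => y; have := IH y; rewrite /= -/h; lra.
move: step; rewrite resolventD resolventZ.
have := Gamma_resolvent_le_variance h x.
have := Gamma_resolvent_le (P h) x CD.
have m0 : 0 <= m%:R :> R by [].
nra.
Qed.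

Lemma resolvent_iter_lipschitz m f x y : CD0infty R G ->
  (forall z, `|f z| <= 1) -> edge x y ->
  m%:R * (resolvent_iter m.+1 f y - resolvent_iter m.+1 f x) ^+ 2 <= 1.
Proof.
move=> CD f1 xy.
have := reverse_poincare m f x CD.
have := sqr_edge_le_Gamma (resolvent_iter m.+1 f) xy.
have : resolvent_iter m (fun z => f z ^+ 2) x <= 1.
  have := @resolvent_iter_le R G m (fun z => f z ^+ 2) (fun=> 1) _ x.
  rewrite resolvent_iter_cst; apply => z.
  by have := f1 z; rewrite ler_norml => /andP[]; nra.
have := sqr_ge0 (resolvent_iter m f x).
have m0 : 0 <= m%:R :> R by [].
nra.
Qed.

(** * The kernel of the iterated resolvent *)

Definition resolvent_kernel m x z : R :=
  resolvent_iter m (fun y => (y == z)%:R) x.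

Lemma sum_eq_mull z f : \sum_x (x == z)%:R * f x = f z.
Proof.
rewrite (bigD1 z)//= eqxx mul1r big1 ?addr0// => x /negbTE ->.
by rewrite mul0r.
Qed.

Lemma resolvent_iterE m f x :
  resolvent_iter m f x = \sum_z resolvent_kernel m z x * f z.
Proof. by rewrite -resolvent_iter_sym sum_eq_mull. Qed.

Lemma kernel_sym m x z : resolvent_kernel m x z = resolvent_kernel m z x.
Proof.
rewrite {1}/resolvent_kernel resolvent_iterE.
rewrite -[RHS](sum_eq_mull z (resolvent_kernel m ^~ x)).
by apply: eq_bigr => y _; rewrite mulrC.
Qed.

Lemma kernel_ge0 m x z : 0 <= resolvent_kernel m x z.
Proof. by apply: resolvent_iter_ge0 => y; case: (y == z). Qed.

Lemma sum_kernel m z : \sum_x resolvent_kernel m x z = 1.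
Proof.
have := resolvent_iterE m (fun=> 1) z; rewrite resolvent_iter_cst => ->.
by apply: eq_bigr => x _; rewrite mulr1.
Qed.

(** Testing the Lipschitz bound on the sign of the difference of the two rows turns it into their l1
    distance. Taking a square [k ^ 2] for the number of steps makes its square root an integer. *)
Lemma kernel_edge_le k x y : CD0infty R G -> edge x y ->
  k%:R * \sum_z
    `|resolvent_kernel (k ^ 2).+1 y z - resolvent_kernel (k ^ 2).+1 x z| <= 1.
Proof.
move=> CD xy; set m := (k ^ 2)%N.
pose f z : R := Num.sg (resolvent_kernel m.+1 y z - resolvent_kernel m.+1 x z).
have f1 z : `|f z| <= 1 by rewrite /f normr_sg lern1 leq_b1.
have := resolvent_iter_lipschitz m CD f1 xy.
set s := \sum_z _.
have -> : resolvent_iter m.+1 f y - resolvent_iter m.+1 f x = s.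
  rewrite !resolvent_iterE -sumrB; apply: eq_bigr => z _.
  rewrite -mulrBl kernel_sym [resolvent_kernel _ z x]kernel_sym.
  by rewrite mulrC -normrEsg.
rewrite natrX -exprMn expr_le1// mulr_ge0// sumr_ge0//.
Qed.

(** A 1-Lipschitz [h] has L h <= D, hence P h = h + P (L h) <= h + D; each iterate adds at most
    [D]. *)
Lemma resolvent_iter_le_lipschitz D m h x : (max_deg G <= D)%N ->
  (forall x y, edge x y -> h y <= h x + 1) ->
  resolvent_iter m h x <= h x + m%:R * D%:R.
Proof.
move=> degD hL; elim: m x => [|m IH] x; first by rewrite mul0r addr0.
rewrite /=; apply: (le_trans (resolvent_le IH x)).
rewrite resolventD resolvent_cst.
have LhD y : L h y <= D%:R.
  apply: (@le_trans _ _ (\sum_(w | edge y w) 1)).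
    by apply: ler_sum => w yw; rewrite lerBlDl hL.
  rewrite sum_deg mulr1 ler_nat (leq_trans _ degD)//.
  exact: (@leq_bigmax _ (@deg G)).
have := resolvent_le LhD x; rewrite resolvent_cst -laplacian_resolvent.
have := resolventP h x; rewrite -natr1; lra.
Qed.

End Gradient.

(** * Balls and their growth *)

Section Ball.
Variable G : graph.
Implicit Types (x y z : G).

Fixpoint ball z (k : nat) : {set G} :=
  if k is k'.+1 then (\bigcup_(x in ball z k') (x |: [set y | edge x y]))%SET
  else [set z]%SET.

Lemma ballS z k x y : x \in ball z k -> (y == x) || edge x y ->
  y \in ball z k.+1.
Proof. by move=> xB xy; apply/bigcupP; exists x => //; rewrite !inE. Qed.

Lemma center_in_ball z k : z \in ball z k.
Proof.
by elim: k => [|k IH]; [rewrite inE|apply: (ballS IH); rewrite eqxx].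
Qed.

Lemma ball_le z j k x : (j <= k)%N -> x \in ball z j -> x \in ball z k.
Proof.
move=> /subnK <-; elim: (k - j)%N => [//|i IH] /IH xB.
by rewrite addSn; apply: (ballS xB); rewrite eqxx.
Qed.

Lemma card_ball_le D z k : (max_deg G <= D)%N -> (#|ball z k| <= D.+1 ^ k)%N.
Proof.
move=> degD; elim: k => [|k IH]; first by rewrite cards1.
rewrite expnSr; apply: leq_trans (leq_mul IH (leqnn _)).
rewrite -sum_nat_const /=.
apply: (big_ind2 (fun (A : {set G}) n => (#|A| <= n)%N)).
- by rewrite cards0.
- move=> A m B n Am Bn; apply: leq_trans (leq_add Am Bn).
  by rewrite cardsU leq_subr.
- move=> x _; rewrite cardsU1 -add1n leq_add ?leq_b1//.
  exact: leq_trans (leq_bigmax (F := @deg G) x) degD.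
Qed.

End Ball.

(** * Concentration of the kernel against the spectral gap *)

Section Expansion.
Variables (R : realType) (G : graph).
Implicit Types (f g h : G -> R) (x y z : G).

(* The distance to [z], truncated at [r]. *)
Definition ball_height z r x : R := (\sum_(k < r) (x \notin ball z k))%:R.

Lemma ball_height_lipschitz z r x y : edge x y ->
  ball_height z r y <= ball_height z r x + 1.
Proof.
move=> xy; rewrite /ball_height natr1 ler_nat.
case: r => [|r]; first by rewrite !big_ord0.
(* Shift by one radius: the first term of the sum for [y] costs at most 1, the last term of the sum
   for [x] is dropped, and [x] in the ball of radius k puts [y] in that of radius k + 1. *)
rewrite big_ord_recl [in leqRHS]big_ord_recr /= -addn1 addnC leq_add ?leq_b1//.
apply: leq_trans (leq_addr _ _); apply: leq_sum => k _.
have [xB|_] := boolP (x \in ball z k); last exact: leq_b1.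
by rewrite (@ballS _ z k x y)// xy orbT.
Qed.

(** Markov's inequality for the height, which is [r] outside the ball and whose mean under the
    kernel is at most [m * D]. *)
Lemma kernel_tail D m r z : (max_deg G <= D)%N ->
  r%:R * \sum_(x | x \notin ball z r) resolvent_kernel R m x z <= (m * D)%:R.
Proof.
move=> degD.
have := resolvent_iter_le_lipschitz m z degD (@ball_height_lipschitz z r).
have -> : ball_height z r z = 0.
  by rewrite /ball_height big1// => k _; rewrite center_in_ball.
rewrite add0r -natrM; apply: le_trans.
rewrite resolvent_iterE mulr_sumr.
rewrite [X in _ <= X](bigID (fun x => x \notin ball z r))/= -[X in X <= _]addr0.
apply: lerD; last first.
  by apply: sumr_ge0 => x _; rewrite mulr_ge0 ?kernel_ge0.
apply: ler_sum => x xB; rewrite kernel_sym mulrC ler_wpM2l ?kernel_ge0//.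
rewrite /ball_height ler_nat -[X in (X <= _)%N](card_ord r) -sum1_card.
apply: leq_sum => k _; suff -> : x \notin ball z k by [].
by apply: contra xB; apply: ball_le; exact: ltnW.
Qed.

(** Cauchy-Schwarz against the indicator of [A]. *)
Lemma sqr_sum_le (A : pred G) f :
  (\sum_(x | A x) f x) ^+ 2 <= #|A|%:R * \sum_(x | A x) f x ^+ 2.
Proof.
have -> : #|A|%:R * \sum_(x | A x) f x ^+ 2 =
    \sum_(x | A x) \sum_(y | A y) 2^-1 * (f x ^+ 2 + f y ^+ 2).
  under [RHS]eq_bigr do rewrite -mulr_sumr big_split/= sumr_const.
  rewrite -mulr_sumr big_split/= sumr_const sumrMnl.
  by rewrite -[(\sum_(i | A i) _) *+ _]mulr_natl; field.
rewrite expr2 mulr_suml; apply: ler_sum => x _.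
rewrite mulr_sumr; apply: ler_sum => y _.
by have := sqr_ge0 (f x - f y); nra.
Qed.

(** For a, b >= 0 one has (b - a)^2 <= |b - a| (a + b) = |b^2 - a^2|. *)
Lemma dirichlet_sqrt_le f : (forall x, 0 <= f x) ->
  dirichlet (fun x => Num.sqrt (f x)) <=
    \sum_x \sum_(y | edge x y) `|f y - f x|.
Proof.
move=> f0; apply: ler_sum => x _; apply: ler_sum => y _.
have := sqr_sqrtr (f0 x); have := sqr_sqrtr (f0 y).
have := sqrtr_ge0 (f x); have := sqrtr_ge0 (f y).
set a := Num.sqrt (f x); set b := Num.sqrt (f y) => b0 a0 <- <-.
have [ab|ba] := lerP a b.
  rewrite ger0_norm; nra.
rewrite ltr0_norm; nra.
Qed.

(** The root [phi] of the kernel has unit l2 norm. By Cauchy-Schwarz its squared sum is at most n/8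
    on the small ball and at most n/8 off it, where little mass lies; [phi] is therefore far from
    constant and the Poincaré inequality applies. *)
Lemma sum_edge_kernel_ge D m r rho z : (max_deg G <= D)%N ->
  lambda R G 2 <= rho -> rho < 1 ->
  (8 * m * D < r)%N -> (8 * D.+1 ^ r <= #|G|)%N ->
  2 * (1 - rho) <= \sum_x \sum_(y | edge x y)
    `|resolvent_kernel R m y z - resolvent_kernel R m x z|.
Proof.
move=> degD l2 rho1 mr nG.
set n : R := #|G|%:R.
have n0 : 0 < n.
  by rewrite ltr0n (leq_trans _ nG)// muln_gt0 expn_gt0.
pose phi x := Num.sqrt (resolvent_kernel R m x z).
apply: (@le_trans _ _ (dirichlet phi)); last first.
  by apply: dirichlet_sqrt_le => x; exact: kernel_ge0.
have phi2 x : phi x ^+ 2 = resolvent_kernel R m x z.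
  by rewrite sqr_sqrtr// kernel_ge0.
have := poincare phi l2 rho1; rewrite -/n.
under eq_bigr do rewrite phi2; rewrite sum_kernel mulr1.
set E := dirichlet phi.
set B := [pred x | x \in ball z r].
have B8 : 8 * #|B|%:R <= n.
  rewrite -natrM ler_nat (leq_trans _ nG)// leq_mul2l/=.
  exact: card_ball_le.
have tail : \sum_(x | ~~ B x) resolvent_kernel R m x z <= 8^-1.
  have := kernel_tail m r z degD; rewrite -/(B _).
  set t := \sum_(x | _) _ => tr.
  have t0 : 0 <= t by apply: sumr_ge0 => x _; exact: kernel_ge0.
  (* The strict inequality keeps [r] positive even when [m * D] is 0. *)
  have : 8 * (m * D)%:R + 1 <= r%:R :> R by rewrite -natrM natr1 mulnA ler_nat.
  have : 0 <= (m * D)%:R :> R by [].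
  nra.
have SB : (\sum_(x | B x) phi x) ^+ 2 <= #|B|%:R.
  apply: le_trans (sqr_sum_le _ _) _.
  rewrite -[leRHS]mulr1 ler_wpM2l//.
  rewrite -(sum_kernel R m z) [leRHS](bigID B)/=.
  rewrite (eq_bigr _ (fun x _ => phi2 x)).
  by rewrite lerDl sumr_ge0// => x _; exact: kernel_ge0.
have SC : (\sum_(x | ~~ B x) phi x) ^+ 2 <= n * 8^-1.
  apply: le_trans (sqr_sum_le (predC B) _) _.
  rewrite (eq_bigr _ (fun x _ => phi2 x)) ler_pM//.
    by apply: sumr_ge0 => x _; exact: kernel_ge0.
  by rewrite ler_nat max_card.
rewrite (bigID B)/=.
move: SB SC; set a := \sum_(x | B x) _; set b := \sum_(x | ~~ B x) _ => SB SC.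
(* By (a + b)^2 <= 2 a^2 + 2 b^2; at least half of n survives in the variance, which turns 4 into
   2. *)
have ab : (a + b) ^+ 2 <= n / 2.
  by have := sqr_ge0 (a - b); nra.
move=> H; rewrite -(ler_pM2l n0).
have rho0 : 0 <= 1 - rho by rewrite subr_ge0 ltW.
nra.
Qed.

(** Double counting over all columns [z]: each contributes at least 2 (1 - rho), whereas after
    exchanging sums each directed edge contributes at most 1/k in total, and there are at most [D]
    times [#|G|] of them. *)
Lemma card_lt_of_gap D k rho : CD0infty R G -> (max_deg G <= D)%N ->
  lambda R G 2 <= rho -> rho < 1 -> D%:R < k%:R * (2 * (1 - rho)) ->
  (#|G| < 8 * D.+1 ^ (8 * (k ^ 2).+1 * D).+1)%N.
Proof.
move=> CD degD l2 rho1 kD; rewrite ltnNge; apply/negP => nG.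
(* [ltnSn] selects the least admissible radius, one more than 8 [D] times the number of steps. *)
have lower z := sum_edge_kernel_ge z degD l2 rho1 (ltnSn _) nG.
have /card_gt0P[z0 _] : (0 < #|G|)%N.
  by rewrite (leq_trans _ nG)// muln_gt0 expn_gt0.
pose Phi z := \sum_x \sum_(y | edge x y)
  `|resolvent_kernel R (k ^ 2).+1 y z - resolvent_kernel R (k ^ 2).+1 x z|.
have : k%:R * \sum_z Phi z <= \sum_(z : G) D%:R.
  rewrite exchange_big/= mulr_sumr; apply: ler_sum => x _.
  rewrite exchange_big/= mulr_sumr.
  apply: (@le_trans _ _ (\sum_(y | edge x y) 1)).
    by apply: ler_sum => y xy; exact: kernel_edge_le.
  rewrite sum_deg mulr1 ler_nat.
  exact: leq_trans (leq_bigmax (F := @deg G) x) degD.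
apply/negP; rewrite -ltNge mulr_sumr.
apply: ltr_sum => [|z _].
  by apply/hasP; exists z0; rewrite ?mem_index_enum.
by apply: lt_le_trans kD _; rewrite ler_wpM2l// lower.
Qed.

End Expansion.

Theorem mainTheorem2 (R : realType) :
  ~ exists (Delta rho : R) (G : nat -> graph),
      [/\ 1 <= Delta, rho < 1,
          (fun n => #|G n|) @ \oo --> \oo
        & forall n, (1 <= n)%N ->
            [/\ (max_deg (G n))%:R <= Delta,
                lambda R (G n) 2 <= rho
              & CD0infty R (G n)]].
Proof.
move=> [Delta [rho [G [Delta1 rho1 cardG HG]]]].
(* Degrees are integers, so they are bounded by the integer part of [Delta]. *)
set D := Num.trunc Delta.
have [k kD] : exists k : nat, D%:R < k%:R * (2 * (1 - rho)).
  have c0 : 0 < 2 * (1 - rho) by rewrite mulr_gt0// subr_gt0.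
  exists (Num.trunc (D%:R / (2 * (1 - rho)))).+1.
  by rewrite -ltr_pdivrMr// truncnS_gt.
set N := (8 * D.+1 ^ (8 * (k ^ 2).+1 * D).+1)%N.
have : \forall n \near \oo, (N <= #|G n|)%N.
  exact: (cardG [set i | (N <= i)%N] (nbhs_infty_ge N)).
(* The successor of the threshold is also at least 1, as the hypotheses on the family require. *)
move=> [n0 _ /(_ n0.+1 (leqnSn _))] /=; apply/negP; rewrite -ltnNge.
have [degD l2 CD] := HG n0.+1 isT.
apply: (card_lt_of_gap CD _ l2 rho1 kD).
by rewrite truncn_ge_nat// (le_trans ler01 Delta1).
Qed.
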